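(* Let $T\ge 2$, $G>0$, $\varepsilon>0$, and let $\ell_1,\dots,\ell_T:\mathbb{R}^d\to\mathbb{R}$ be convex $G$-Lipschitz losses (each $\ell_t$ may be chosen adversarially, after $w_1,\dots,w_t$ are revealed). Run the Dynamic Regret Algorithm described in the context with inputs $G,\varepsilon,T$, producing $w_1,\dots,w_T$ from subgradients $g_t\in\partial\ell_t(w_t)$. Then for every $u_1,\dots,u_T\in\mathbb{R}^d$, $$\sum_{t=1}^T\big(\ell_t(w_t)-\ell_t(u_t)\big)\le 2\varepsilon G+6\sqrt{2(M+P_T)\,L_T\sum_{t=1}^T\|g_t\|^2\|u_t\|}+4G(M+P_T)\,L_T,$$ where $M=\max_{t\le T}\|u_t\|$, $P_T=\sum_{t=2}^{T}\|u_t-u_{t-1}\|$, $L_T=\max\left\{\log\left(\frac{9M\Lambda_T}{4\varepsilon}+1\right),1\right\}$ and $$\Lambda_T=T^2\left(4+\frac{\sum_{t=1}^T\|g_t\|^2}{G^2}\right)\log^2\left(4+\frac{\sum_{t=1}^T\|g_t\|^2}{G^2}\right)\lceil\log_2(\sqrt T)\rceil\ \ (\le O(T^3\log^3 T)).$$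
   Context: $\|\cdot\|$ is the Euclidean norm, $\log$ is the natural logarithm. Dynamic Regret Algorithm. Input: $G>0$, $\varepsilon>0$, horizon $T$. Step-size grid: $\mathcal{S}=\left\{\min\left(\frac{2^k}{G\sqrt T},\frac1G\right):1\le k\le\lceil\log_2\sqrt T\rceil\right\}$. Set $\epsilon=\varepsilon/|\mathcal S|=\varepsilon/\lceil\log_2(\sqrt T)\rceil$, $V_1=4G^2$, $w_1^\eta=0\in\mathbb{R}^d$ for each $\eta\in\mathcal S$, and $\alpha_t=\frac{\epsilon G^2}{V_t\log^2(V_t/G^2)}$ for all $t\ge1$. For $t=1,\dots,T$: play $w_t=\sum_{\eta\in\mathcal S}w_t^\eta$; receive $g_t\in\partial\ell_t(w_t)$; set $V_{t+1}=V_t+\|g_t\|^2$ (and hence $\alpha_{t+1}$); and for each $\eta\in\mathcal S$ set $$\theta_t^\eta=\frac{2w_t^\eta\log(\|w_t^\eta\|/\alpha_t+1)}{\eta\|w_t^\eta\|}-g_t\quad(\theta_t^\eta=-g_t\text{ if }w_t^\eta=0),$$ $$w_{t+1}^\eta=\frac{\alpha_{t+1}\theta_t^\eta}{\|\theta_t^\eta\|}\left[\exp\left(\frac\eta2\max\left(\|\theta_t^\eta\|-2\eta\|g_t\|^2,0\right)\right)-1\right]\quad(w_{t+1}^\eta=0\text{ if }\theta_t^\eta=0).$$ *)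

(* Defs.v *)
(* Vectors of R^d are row vectors 'rV[R]_d.
   Time is 0-based: index t : nat stands for round t+1, so the T rounds are the
   t < T.  Losses, subgradients and comparators are sequences indexed by nat of
   which only the first T terms matter. *)
From HB Require Import structures.
From mathcomp Require Export all_boot all_order all_algebra.
From mathcomp Require Export all_classical all_reals all_analysis.

Set Implicit Arguments.
Unset Strict Implicit.
Unset Printing Implicit Defensive.

Import Order.TTheory GRing.Theory Num.Theory.
Local Open Scope ring_scope.

Definition dotp (R : realType) (d : nat) (x y : 'rV[R]_d) : R :=
  \sum_i x 0 i * y 0 i.

(* The library norm `|x| on 'rV[R]_d is the sup norm, not the Euclidean one. *)
Definition enorm (R : realType) (d : nat) (x : 'rV[R]_d) : R :=
  Num.sqrt (dotp x x).

Definition elipschitz (R : realType) (d : nat) (G : R) (f : 'rV[R]_d -> R) :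
    Prop :=
  forall x y, `|f x - f y| <= G * enorm (x - y).

Definition subgradient (R : realType) (d : nat) (f : 'rV[R]_d -> R)
    (x v : 'rV[R]_d) : Prop :=
  forall y, f x + dotp v (y - x) <= f y.

(* ceil (log_2 (sqrt T)); the integer under absz is positive when 1 < T *)
Definition grid_count (R : realType) (T : nat) : nat :=
  `|Num.ceil (ln (Num.sqrt (T%:R : R)) / ln 2)|%N.

(* The finite set of step sizes, as a duplicate-free sequence. *)
Definition grid (R : realType) (G : R) (T : nat) : seq R :=
  undup [seq Num.min (2 ^+ k / (G * Num.sqrt T%:R)) G^-1
        | k <- iota 1 (grid_count R T)].

Fixpoint Vseq (R : realType) (d : nat) (G : R) (g : nat -> 'rV[R]_d) (t : nat) :
    R :=
  if t is s.+1 then Vseq G g s + enorm (g s) ^+ 2 else 4 * G ^+ 2.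

Definition alpha (R : realType) (d : nat) (G eps : R) (T : nat)
    (g : nat -> 'rV[R]_d) (t : nat) : R :=
  (eps / (size (grid G T))%:R) * G ^+ 2
  / (Vseq G g t * ln (Vseq G g t / G ^+ 2) ^+ 2).

Definition theta (R : realType) (d : nat) (eta a : R) (w v : 'rV[R]_d) :
    'rV[R]_d :=
  if w == 0 then - v
  else (2 * ln (enorm w / a + 1) / (eta * enorm w)) *: w - v.

(* One update from iterate w and subgradient v, with a and a' the current and
   next values of alpha. *)
Definition expert_step (R : realType) (d : nat) (eta a a' : R)
    (w v : 'rV[R]_d) : 'rV[R]_d :=
  let th := theta eta a w v in
  if th == 0 then 0
  else (a' / enorm th *
        (expR (eta / 2 * Num.max (enorm th - 2 * eta * enorm v ^+ 2) 0) - 1))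
       *: th.

Fixpoint expert (R : realType) (d : nat) (G eps : R) (T : nat)
    (g : nat -> 'rV[R]_d) (eta : R) (t : nat) : 'rV[R]_d :=
  if t is s.+1 then
    expert_step eta (alpha G eps T g s) (alpha G eps T g s.+1)
                (expert G eps T g eta s) (g s)
  else 0.

(* The point played in round t; it depends on g 0, ..., g (t - 1) only. *)
Definition play (R : realType) (d : nat) (G eps : R) (T : nat)
    (g : nat -> 'rV[R]_d) (t : nat) : 'rV[R]_d :=
  \sum_(eta <- grid G T) expert G eps T g eta t.

Definition max_norm (R : realType) (d T : nat) (u : nat -> 'rV[R]_d) : R :=
  \big[Num.max/0]_(t < T) enorm (u t).

Definition path_length (R : realType) (d T : nat) (u : nat -> 'rV[R]_d) : R :=
  \sum_(1 <= t < T) enorm (u t - u t.-1).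

Definition Lambda (R : realType) (d : nat) (G : R) (T : nat)
    (g : nat -> 'rV[R]_d) : R :=
  let q := 4 + (\sum_(t < T) enorm (g t) ^+ 2) / G ^+ 2 in
  T%:R ^+ 2 * q * ln q ^+ 2 * (grid_count R T)%:R.

Definition log_factor (R : realType) (d : nat) (G eps : R) (T : nat)
    (g u : nat -> 'rV[R]_d) : R :=
  Num.max (ln (9 * max_norm T u * Lambda G T g / (4 * eps) + 1)) 1.

(* Main.v *)
Require Import Defs.
From mathcomp Require Import ring lra.
Import Order.TTheory GRing.Theory Num.Theory.
Local Open Scope ring_scope.

(** Each expert is mirror descent for the regularizer
    [2 / eta * \int_0^|w| ln (s / alpha + 1) ds] with the extra penalty
    [2 * eta * |g|^2 * |w|].  Write [z_t = ln (|w_t| / alpha_t + 1)] for the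
    level of the iterate and [p_t] for the gradient of the regularizer there, so
    [|p_t| = 2 / eta * z_t].  Half of the penalty absorbs the stability term, up
    to [eta * alpha_t * |g_t|^2], which is summable because
    [alpha_t ~ 1 / (V_t ln^2 V_t)]; the other half leaves a gain
    [eta * |g_t|^2 * |w_{t+1}|].  Summation by parts against the comparators
    costs [\sum |p_t| |u_t - u_{t-1}|], at most [4 / eta * L * P] when all
    levels are at most [2 L].  If the largest level [Z] exceeds [2 L], then
    climbing from [Z - 1] to [Z] at speed [eta / 2 * |g_t|] forces
    [\sum |g_t|^2 >= 4 / (eta^2 T)] over rounds in which [|w_{t+1}|] is
    exponentially large in [Z], and the gain pays for the excess.  Every expert
    has regret [O(eps G / N)] against [0], so the sum of the [N] experts
    competes with the best step size of the grid. *)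

Set Implicit Arguments.
Unset Strict Implicit.
Unset Printing Implicit Defensive.

(** * Euclidean geometry *)

Lemma dotpC (R : realType) (d : nat) (x y : 'rV[R]_d) : dotp x y = dotp y x.
Proof. by apply: eq_bigr => i _; rewrite mulrC. Qed.

Lemma dotpDl (R : realType) (d : nat) (x y z : 'rV[R]_d) :
  dotp (x + y) z = dotp x z + dotp y z.
Proof. by rewrite -big_split; apply: eq_bigr => i _; rewrite !mxE mulrDl. Qed.

Lemma dotpZl (R : realType) (d : nat) (a : R) (x y : 'rV[R]_d) :
  dotp (a *: x) y = a * dotp x y.
Proof. by rewrite /dotp mulr_sumr; apply: eq_bigr => i _; rewrite !mxE mulrA. Qed.

Lemma dotpDr (R : realType) (d : nat) (x y z : 'rV[R]_d) :
  dotp x (y + z) = dotp x y + dotp x z.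
Proof. by rewrite dotpC dotpDl !(dotpC x). Qed.

Lemma dotpZr (R : realType) (d : nat) (a : R) (x y : 'rV[R]_d) :
  dotp x (a *: y) = a * dotp x y.
Proof. by rewrite dotpC dotpZl dotpC. Qed.

Lemma dotpNl (R : realType) (d : nat) (x y : 'rV[R]_d) :
  dotp (- x) y = - dotp x y.
Proof. by rewrite -scaleN1r dotpZl mulN1r. Qed.

Lemma dotpNr (R : realType) (d : nat) (x y : 'rV[R]_d) :
  dotp x (- y) = - dotp x y.
Proof. by rewrite dotpC dotpNl dotpC. Qed.

Lemma dotp0l (R : realType) (d : nat) (x : 'rV[R]_d) : dotp 0 x = 0.
Proof. by rewrite -(scale0r x) dotpZl mul0r. Qed.

Lemma dotp_suml (R : realType) (d : nat) (I : Type) (r : seq I)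
    (F : I -> 'rV[R]_d) (x : 'rV[R]_d) :
  dotp (\sum_(i <- r) F i) x = \sum_(i <- r) dotp (F i) x.
Proof.
elim: r => [|i r IH]; first by rewrite !big_nil dotp0l.
by rewrite !big_cons dotpDl IH.
Qed.

Lemma dotp_ge0 (R : realType) (d : nat) (x : 'rV[R]_d) : 0 <= dotp x x.
Proof. by apply: sumr_ge0 => i _; rewrite -expr2 sqr_ge0. Qed.

Lemma enorm_ge0 (R : realType) (d : nat) (x : 'rV[R]_d) : 0 <= enorm x.
Proof. exact: sqrtr_ge0. Qed.

Lemma enorm_sqr (R : realType) (d : nat) (x : 'rV[R]_d) :
  enorm x ^+ 2 = dotp x x.
Proof. by rewrite sqr_sqrtr // dotp_ge0. Qed.

Lemma enorm_eq0 (R : realType) (d : nat) (x : 'rV[R]_d) :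
  (enorm x == 0) = (x == 0).
Proof.
apply/eqP/eqP => [x0|->]; last by rewrite /enorm dotp0l sqrtr0.
have /eqP : dotp x x = 0 by rewrite -enorm_sqr x0 expr0n.
rewrite psumr_eq0 => [/allP h|i _]; last by rewrite -expr2 sqr_ge0.
apply/rowP => i; have := h i (mem_index_enum _).
by rewrite mxE /= mulf_eq0 orbb => /eqP.
Qed.

Lemma enorm0 (R : realType) (d : nat) : enorm (0 : 'rV[R]_d) = 0.
Proof. by apply/eqP; rewrite enorm_eq0. Qed.

Lemma enormZ (R : realType) (d : nat) (a : R) (x : 'rV[R]_d) :
  enorm (a *: x) = `|a| * enorm x.
Proof.
by rewrite /enorm dotpZl dotpZr mulrA -expr2 sqrtrM ?sqr_ge0 // sqrtr_sqr.
Qed.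

Lemma enormN (R : realType) (d : nat) (x : 'rV[R]_d) : enorm (- x) = enorm x.
Proof. by rewrite -scaleN1r enormZ normrN1 mul1r. Qed.

Lemma dotp_le (R : realType) (d : nat) (x y : 'rV[R]_d) :
  dotp x y <= enorm x * enorm y.
Proof.
have [->|x0] := eqVneq x 0; first by rewrite dotp0l enorm0 mul0r.
have [->|y0] := eqVneq y 0; first by rewrite dotpC dotp0l enorm0 mulr0.
have hx : 0 < enorm x by rewrite lt0r enorm_eq0 x0 enorm_ge0.
have hy : 0 < enorm y by rewrite lt0r enorm_eq0 y0 enorm_ge0.
have := dotp_ge0 (enorm y *: x - enorm x *: y).
rewrite dotpDl !dotpDr !dotpNl !dotpNr !dotpZl !dotpZr (dotpC y x) -!enorm_sqr.
move=> h; rewrite -(ler_pM2l (mulr_gt0 hx hy)).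
by lra.
Qed.

Lemma dotp_geN (R : realType) (d : nat) (x y : 'rV[R]_d) :
  - (enorm x * enorm y) <= dotp x y.
Proof. by rewrite -(enormN x) lerNl -dotpNl dotp_le. Qed.

Lemma enormD (R : realType) (d : nat) (x y : 'rV[R]_d) :
  enorm (x + y) <= enorm x + enorm y.
Proof.
rewrite -(@ler_pXn2r _ 2) ?nnegrE ?addr_ge0 ?enorm_ge0 //.
rewrite enorm_sqr dotpDl !dotpDr (dotpC y x) -!enorm_sqr.
by have := dotp_le x y; lra.
Qed.

Lemma enormB (R : realType) (d : nat) (x y : 'rV[R]_d) :
  enorm (x - y) <= enorm x + enorm y.
Proof. by rewrite -(enormN y) enormD. Qed.

(** * Convexity of the entropy *)

Lemma is_derive_ge0_homo (R : realType) (f df : R -> R) :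
  (forall x : R, is_derive x (1 : R) f (df x)) -> (forall x, 0 <= df x) ->
  {homo f : x y / x <= y}.
Proof.
move=> fd df0 x y xy.
have h := @ger0_derive1_le_cc R f x y.
apply: h => //; rewrite ?in_itv /= ?lexx ?xy //.
- by move=> z _; rewrite derive1E derive_val.
- apply: derivable_within_continuous => z _; exact: ex_derive.
Qed.

Lemma sinh_ge (R : realType) (x : R) : 0 <= x -> 2 * x <= expR x - expR (- x).
Proof.
move=> x0; rewrite -subr_ge0.
pose f (y : R) : R := expR y - expR (- y) - 2 * y.
have fd (y : R) : is_derive y (1 : R) f (expR y + expR (- y) - 2).
  rewrite /f; apply: is_derive_eq; rewrite /= /GRing.scale /=.
  by ring.
suff: f 0 <= f x by rewrite /f oppr0 mulr0 !subrr.
apply: (is_derive_ge0_homo fd) => // y.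
(* The derivative is [4 sinh^2 (y / 2)]. *)
have -> : expR y + expR (- y) - 2 = (expR (y / 2) - expR (- (y / 2))) ^+ 2.
  have e1 : expR y = expR (y / 2) ^+ 2 by rewrite expr2 -expRD; congr expR; field.
  have e2 : expR (- y) = expR (- (y / 2)) ^+ 2.
    by rewrite expr2 -expRD; congr expR; field.
  by have := expRxMexpNx_1 (y / 2); rewrite e1 e2 => e3; ring: e3.
exact: sqr_ge0.
Qed.

(** The difference of the two sides vanishes at [0] and has derivative
    [2 * (1 - expR (- x)) ^+ 2]. *)
Lemma expRN_quadratic (R : realType) (x : R) : 0 <= x ->
  (1 - expR (- x)) ^+ 2 <= 2 * (x - 1 + expR (- x)).
Proof.
move=> x0; rewrite -subr_ge0.
pose f (y : R) : R := 2 * (y - 1 + expR (- y)) - (1 - expR (- y)) ^+ 2.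
have fd (y : R) : is_derive y (1 : R) f (2 * (1 - expR (- y)) ^+ 2).
  rewrite /f; apply: is_derive_eq; rewrite /= /GRing.scale /=.
  by ring.
suff: f 0 <= f x by rewrite /f oppr0 expR0 !subrr; lra.
by apply: (is_derive_ge0_homo fd) => // y; rewrite mulr_ge0 // sqr_ge0.
Qed.

(* Strong convexity of the negative entropy [y ln y] between [y = expR z] and
   [y' = expR z']; the left-hand side is its Bregman divergence. *)
Lemma entropy_bregman_ge (R : realType) (z z' m : R) :
  expR z <= m -> expR z' <= m ->
  (expR z - expR z') ^+ 2 <= 2 * m * ((z' - z) * expR z' - expR z' + expR z).
Proof.
move=> zm z'm.
have [zz'|z'z] := leP z z'.
  have h : 0 <= z' - z by lra.
  have {h} := expRN_quadratic h.
  have -> : expR z = expR z' * expR (- (z' - z)).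
    by rewrite -expRD; congr expR; ring.
  set q := expR (- _) => h.
  have e0 := expR_gt0 z'.
  have -> : (expR z' * q - expR z') ^+ 2 = expR z' ^+ 2 * (1 - q) ^+ 2 by ring.
  have -> : 2 * m * ((z' - z) * expR z' - expR z' + expR z' * q) =
    m * expR z' * (2 * (z' - z - 1 + q)) by ring.
  apply: ler_pM; rewrite ?sqr_ge0 // expr2.
  by rewrite ler_pM2r.
have h : 0 <= z - z' by lra.
have {h} := sinh_ge h.
have -> : expR z = expR z' * expR (z - z') by rewrite -expRD; congr expR; ring.
have := expRxMexpNx_1 (z - z').
have : 1 <= expR (z - z') by rewrite -expR0 ler_expR; lra.
have -> : expR z' * expR (z - z') = expR z by rewrite -expRD; congr expR; ring.
have e3 : expR z = expR z' * expR (z - z') by rewrite -expRD; congr expR; ring.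
move: e3 zm (expR_gt0 z').
set q := expR (z - z'); set r := expR (- (z - z')); set e := expR z'.
move=> e3; rewrite e3 => zm e0 q1 qr h.
have -> : (e * q - e) ^+ 2 = e ^+ 2 * (q - 1) ^+ 2 by ring.
have -> : 2 * m * ((z' - z) * e - e + e * q) =
    m * e * (2 * (z' - z - 1 + q)) by ring.
(* Since [q * r = 1], the difference of the two sides is exactly [q * (q - r - 2 * (z - z'))]. *)
have k : (q - 1) ^+ 2 <= q * (2 * (z' - z - 1 + q)).
  by have : 0 <= q * (q - r - 2 * (z - z')); [rewrite mulr_ge0 //; lra | nra].
apply: (@le_trans _ _ (e ^+ 2 * (q * (2 * (z' - z - 1 + q))))).
  by rewrite ler_pM2l // exprn_gt0.
have k2 : 0 <= 2 * (z' - z - 1 + q).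
  by rewrite -(pmulr_rge0 _ (lt_le_trans ltr01 q1)); apply: le_trans k; exact: sqr_ge0.
rewrite mulrA; apply: ler_wpM2r => //.
by rewrite expr2 -mulrA mulrC ler_pM2r.
Qed.

(** * One step of an expert *)

Definition level (R : realType) (d : nat) (a : R) (w : 'rV[R]_d) : R :=
  ln (enorm w / a + 1).

(* The gradient at [w] of the regularizer
   [2 / eta * \int_0^(enorm w) ln (s / a + 1) ds]; division by zero makes it
   vanish at [w = 0]. *)
Definition mirror (R : realType) (d : nat) (eta a : R) (w : 'rV[R]_d) :
    'rV[R]_d :=
  (2 * level a w / (eta * enorm w)) *: w.

(* The Fenchel conjugate of the regularizer at the gradient of level [z]. *)
Definition conjugate (R : realType) (eta a z : R) : R :=
  2 / eta * a * (expR z - 1 - z).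

Lemma theta_mirror (R : realType) (d : nat) (eta a : R) (w v : 'rV[R]_d) :
  theta eta a w v = mirror eta a w - v.
Proof.
by rewrite /theta /mirror; case: eqVneq => [->|//]; rewrite scaler0 sub0r.
Qed.

Lemma expR_level (R : realType) (d : nat) (a : R) (w : 'rV[R]_d) :
  0 < a -> expR (level a w) = enorm w / a + 1.
Proof.
by move=> a0; rewrite lnK // posrE ltr_wpDl // divr_ge0 ?enorm_ge0 // ltW.
Qed.

Lemma enorm_level (R : realType) (d : nat) (a : R) (w : 'rV[R]_d) :
  0 < a -> enorm w = a * (expR (level a w) - 1).
Proof. by move=> a0; rewrite expR_level //; field; rewrite gt_eqF. Qed.

Lemma level_ge0 (R : realType) (d : nat) (a : R) (w : 'rV[R]_d) :
  0 < a -> 0 <= level a w.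
Proof.
by move=> a0; rewrite ln_ge0 // lerDr divr_ge0 ?enorm_ge0 // ltW.
Qed.

Lemma level0 (R : realType) (d : nat) (a : R) : level a (0 : 'rV[R]_d) = 0.
Proof. by rewrite /level enorm0 mul0r add0r ln1. Qed.

Lemma enorm_mirror (R : realType) (d : nat) (eta a : R) (w : 'rV[R]_d) :
  0 < eta -> 0 < a -> enorm (mirror eta a w) = 2 / eta * level a w.
Proof.
move=> eta0 a0; have [->|w0] := eqVneq w 0.
  by rewrite /mirror scaler0 enorm0 level0 mulr0.
have nw : enorm w != 0 by rewrite enorm_eq0.
rewrite enormZ ger0_norm; last first.
  by rewrite !mulr_ge0 ?level_ge0 // invr_ge0 mulr_ge0 ?enorm_ge0 // ltW.
by field; rewrite nw gt_eqF.
Qed.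

Lemma expert_stepE (R : realType) (d : nat) (eta a a' : R) (w v : 'rV[R]_d) :
  let th := mirror eta a w - v in
  expert_step eta a a' w v =
    (a' / enorm th *
      (expR (eta / 2 * Num.max (enorm th - 2 * eta * enorm v ^+ 2) 0) - 1))
    *: th.
Proof.
rewrite /expert_step theta_mirror /=; case: eqVneq => [->|//].
by rewrite scaler0.
Qed.

Section Step.
Context (R : realType) (d : nat) (eta a a' : R) (w v : 'rV[R]_d).
Hypotheses (eta0 : 0 < eta) (a0 : 0 < a) (a'0 : 0 < a').
Let th := mirror eta a w - v.
Let mu := Num.max (enorm th - 2 * eta * enorm v ^+ 2) 0.
Let w' := expert_step eta a a' w v.

Let mu0 : 0 <= mu.
Proof. by rewrite le_max lexx orbT. Qed.

Let slack_ge0 : 0 <= 2 * eta * enorm v ^+ 2.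
Proof. by rewrite mulr_ge0 ?sqr_ge0 // mulr_ge0 // ltW. Qed.

Let mu_th : mu <= enorm th.
Proof. by rewrite ge_max enorm_ge0 andbT lerBlDr lerDl. Qed.

Let mu_gap : enorm th - mu <= 2 * eta * enorm v ^+ 2.
Proof. by rewrite lerBlDr -lerBlDl le_max lexx. Qed.

Let enorm_step : enorm w' = a' * (expR (eta / 2 * mu) - 1).
Proof.
rewrite /w' expert_stepE -/th -/mu enormZ.
have e1 : 0 <= expR (eta / 2 * mu) - 1.
  by rewrite subr_ge0 -expR0 ler_expR !mulr_ge0 ?invr_ge0 // ltW.
have [th0|th0] := eqVneq th 0.
  have -> : mu = 0 by apply/eqP; rewrite eq_le mu0 (le_trans mu_th) // th0 enorm0.
  by rewrite th0 enorm0 !mulr0 expR0 subrr mulr0.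
have nth : enorm th != 0 by rewrite enorm_eq0.
rewrite ger0_norm; last by rewrite !mulr_ge0 ?invr_ge0 ?enorm_ge0 // ltW.
by field.
Qed.

(** The right-hand side does not mention [a']: the shortened gradient alone fixes the new level, and
    [a'] only sets the scale of the iterate. *)
Lemma level_step :
  level a' w' = eta / 2 * Num.max (enorm th - 2 * eta * enorm v ^+ 2) 0.
Proof.
rewrite /level enorm_step mulrAC divff ?gt_eqF // mul1r subrK expRK //.
Qed.

(** In the dual, the update is soft thresholding: [th] keeps its direction and is shortened to
    length [mu]. *)
Let mirror_step : mirror eta a' w' = (mu / enorm th) *: th.
Proof.
rewrite /mirror level_step -/mu.
have [m0|m0] := eqVneq mu 0.
  have /eqP -> : w' == 0 by rewrite -enorm_eq0 enorm_step m0 mulr0 expR0 subrr mulr0.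
  by rewrite scaler0 m0 mul0r scale0r.
have e1 : expR (eta / 2 * mu) - 1 != 0.
  by rewrite subr_eq0 gt_eqF // expR_gt1 !mulr_gt0 ?invr_gt0 // lt0r m0 mu0.
have nth : enorm th != 0.
  by rewrite gt_eqF // (lt_le_trans _ mu_th) // lt0r m0 mu0.
rewrite enorm_step /w' expert_stepE -/th -/mu scalerA; congr (_ *: _).
by field; rewrite nth e1 !gt_eqF.
Qed.

Lemma level_step_le : level a' w' <= level a w + eta / 2 * enorm v.
Proof.
rewrite level_step -/mu.
have h : enorm th <= 2 / eta * level a w + enorm v.
  by rewrite -(enorm_mirror w eta0 a0) enormB.
apply: (@le_trans _ _ (eta / 2 * (2 / eta * level a w + enorm v))).
  by rewrite ler_wpM2l ?(le_trans mu_th) // divr_ge0 // ltW.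
by rewrite le_eqVlt; apply/orP; left; apply/eqP; field; rewrite gt_eqF.
Qed.

Let th_mirror : th - mirror eta a' w' = (1 - mu / enorm th) *: th.
Proof. by rewrite mirror_step scalerBl scale1r. Qed.

(** The vector is what thresholding removes from [th], a subgradient at [w'] of the penalty; its
    length is [enorm th - mu]. *)
Lemma mirror_step_close :
  enorm (mirror eta a w - v - mirror eta a' w') <= 2 * eta * enorm v ^+ 2.
Proof.
rewrite -/th th_mirror enormZ.
have [th0|th0] := eqVneq th 0.
  by rewrite th0 enorm0 mulr0.
have nth : 0 < enorm th by rewrite lt0r enorm_eq0 th0 enorm_ge0.
rewrite ger0_norm ?subr_ge0 ?ler_pdivrMr ?mul1r //.
by rewrite mulrBl mul1r divfK ?gt_eqF.
Qed.

(** Optimality of the step: if [w'] is nonzero, the removed vector points along [w'] and has the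
    full length of the threshold. *)
Lemma dotp_mirror_step :
  dotp (mirror eta a w - v - mirror eta a' w') w' =
    2 * eta * enorm v ^+ 2 * enorm w'.
Proof.
rewrite -/th th_mirror.
have [m0|m0] := eqVneq mu 0.
  have /eqP -> : w' == 0 by rewrite -enorm_eq0 enorm_step m0 mulr0 expR0 subrr mulr0.
  by rewrite dotpC dotp0l enorm0 mulr0.
have mp : 0 < mu by rewrite lt0r m0 mu0.
have muE : mu = enorm th - 2 * eta * enorm v ^+ 2.
  by move: mp; rewrite /mu lt_max ltxx orbF => /ltW/max_l.
have nth : enorm th != 0 by rewrite gt_eqF // (lt_le_trans mp mu_th).
rewrite enorm_step /w' expert_stepE -/th -/mu dotpZl dotpZr -enorm_sqr.
have -> : 2 * eta * enorm v ^+ 2 = enorm th - mu by rewrite muE; ring.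
by field.
Qed.

End Step.

(** Moving the iterate by [r] gains at most [b * r] and costs the Bregman bound. It is used with
    [x = enorm W + a], so the right-hand side is half of the penalty plus the summable term. *)
Lemma step_quadratic (R : realType) (eta b x r : R) :
  0 < eta -> 0 <= b -> eta * b <= 1 -> 0 < x -> 0 <= r ->
  b * r - r ^+ 2 / (eta * (x + r)) <= eta * b ^+ 2 * x.
Proof.
move=> eta0 b0 b1 x0 r0.
have xr : 0 < x + r by lra.
rewrite lerBlDr -lerBlDl ler_pdivlMr ?mulr_gt0 //.
set c := eta * b in b1 *.
have c0 : 0 <= c by rewrite mulr_ge0 // ltW.
have -> : (b * r - eta * b ^+ 2 * x) * (eta * (x + r)) =
  (c * r - c ^+ 2 * x) * (x + r) by rewrite /c; ring.
rewrite -subr_ge0.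
(* Completing the square in [r]; [c <= 1] keeps both summands nonnegative. *)
have -> : r ^+ 2 - (c * r - c ^+ 2 * x) * (x + r) =
  (1 - c) * (r - c * x / 2) ^+ 2 + c ^+ 2 * x ^+ 2 * (3 + c) / 4 by field.
apply: addr_ge0; first by rewrite mulr_ge0 ?sqr_ge0 // subr_ge0.
rewrite divr_ge0 // mulr_ge0 //; last by lra.
by rewrite mulr_ge0 ?sqr_ge0.
Qed.

(* Only the component of [W] along [w] enters the Bregman divergence, which is
   therefore the one-dimensional one plus a multiple of
   [enorm w * enorm W - dotp w W]. *)
Lemma mirror_bregman_ge (R : realType) (d : nat) (eta a : R) (w W : 'rV[R]_d) :
  0 < eta -> 0 < a ->
  enorm (w - W) ^+ 2 / (eta * (enorm W + a + enorm (w - W))) <=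
  2 / eta * level a W * enorm W - conjugate eta a (level a W)
  + conjugate eta a (level a w) - dotp (mirror eta a w) W.
Proof.
move=> eta0 a0.
set x := enorm w; set x' := enorm W; set r := enorm (w - W).
set z := level a w; set z' := level a W.
have x0 : 0 <= x by exact: enorm_ge0.
have x'0 : 0 <= x' by exact: enorm_ge0.
have r0 : 0 <= r by exact: enorm_ge0.
pose e := x * x' - dotp w W.
have e0 : 0 <= e by rewrite subr_ge0 dotp_le.
have r2 : r ^+ 2 = (x - x') ^+ 2 + 2 * e.
  rewrite enorm_sqr dotpDl !dotpDr !dotpNl !dotpNr (dotpC W w) -!enorm_sqr.
  by rewrite /e /x /x'; ring.
have xr : x <= x' + r.
  by have := enormD (w - W) W; rewrite subrK addrC.
have X : x = a * (expR z - 1) by exact: enorm_level.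
have X' : x' = a * (expR z' - 1) by exact: enorm_level.
have z0 : 0 <= z by exact: level_ge0.
(* The angular part of the divergence is [z * e / x], so the claim reduces to [x <= z * (x + a)],
   that is [1 - expR (- z) <= z]. *)
have ze : e <= (x' * z - eta / 2 * dotp (mirror eta a w) W) * (x + a).
  have [w0|w0] := eqVneq w 0.
    rewrite /mirror w0 scaler0 /e w0 !dotp0l mulr0 !subr0 /x w0 enorm0 mul0r.
    by rewrite add0r !mulr_ge0 // ltW.
  have xp : 0 < x by rewrite lt0r enorm_eq0 w0 enorm_ge0.
  have -> : x' * z - eta / 2 * dotp (mirror eta a w) W = z * e / x.
    rewrite /mirror dotpZl -/z -/x /e.
    by field; rewrite !gt_eqF.
  rewrite mulrAC ler_pdivlMr // mulrAC (mulrC e); apply: ler_wpM2r => //.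
  have h : expR (- z) * expR z = 1 by rewrite mulrC expRxMexpNx_1.
  have k := expR_ge1Dx (- z).
  have ez := expR_gt0 z.
  rewrite X; have -> : a * (expR z - 1) + a = a * expR z by ring.
  rewrite mulrCA; apply: ler_wpM2l; first exact: ltW.
  have := ler_wpM2r (ltW ez) k; rewrite h; lra.
(* [m / a] bounds both exponentials because [x <= x' + r]; it is the common bound for the entropy
   estimate. *)
have m1 : expR z <= (x' + a + r) / a.
  by rewrite ler_pdivlMr //; move: xr; rewrite X; lra.
have m2 : expR z' <= (x' + a + r) / a.
  by rewrite ler_pdivlMr // X'; lra.
have := entropy_bregman_ge m1 m2.
set D1 := (_ - _ + _).
set m := x' + a + r in m1 m2 *.
have mp : 0 < m by rewrite /m; lra.
(* The divergence splits into a radial part [a * D1] and an angular part; below they dominate the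
   terms [(x - x') ^+ 2] and [2 * e] of [r ^+ 2] respectively. *)
have Dr : 2 / eta * z' * x' - conjugate eta a z' + conjugate eta a z
    - dotp (mirror eta a w) W =
    2 / eta * (a * D1 + (x' * z - eta / 2 * dotp (mirror eta a w) W)).
  rewrite /conjugate /D1 X'.
  by field; rewrite gt_eqF.
rewrite Dr => hB.
rewrite ler_pdivrMr ?mulr_gt0 //.
have -> : 2 / eta * (a * D1 + (x' * z - eta / 2 * dotp (mirror eta a w) W)) *
    (eta * m) =
  2 * m * (a * D1) + 2 * (m * (x' * z - eta / 2 * dotp (mirror eta a w) W)).
  by field; rewrite gt_eqF.
rewrite r2; apply: lerD.
  have -> : x - x' = a * (expR z - expR z') by rewrite X X'; ring.
  have -> : 2 * m * (a * D1) = a ^+ 2 * (2 * (m / a) * D1).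
    by field; rewrite gt_eqF.
  by rewrite exprMn ler_wpM2l // sqr_ge0.
rewrite ler_pM2l //; apply: (le_trans ze); rewrite mulrC.
apply: ler_wpM2r; last by rewrite /m; lra.
by rewrite -(pmulr_lge0 _ (_ : 0 < x + a)); [exact: le_trans ze | lra].
Qed.

Lemma conjugate_ge0 (R : realType) (eta a z : R) :
  0 < eta -> 0 < a -> 0 <= conjugate eta a z.
Proof.
move=> eta0 a0; rewrite !mulr_ge0 ?invr_ge0 //; try exact: ltW.
by have := expR_ge1Dx z; lra.
Qed.

Lemma conjugate_le (R : realType) (eta a a' z : R) :
  0 < eta -> a' <= a -> conjugate eta a' z <= conjugate eta a z.
Proof.
move=> eta0 aa'; apply: ler_wpM2r; first by have := expR_ge1Dx z; lra.
by rewrite ler_wpM2l // divr_ge0 // ltW.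
Qed.

(** Optimality of the step and the Bregman bound leave [enorm v * r - r ^+ 2 / (eta * (enorm W + a +
    r))], with [r = enorm (w - W)], minus the full penalty at [W]; [step_quadratic] bounds the first
    two terms. *)
Lemma expert_step_potential (R : realType) (d : nat) (eta a a' : R)
    (w v : 'rV[R]_d) (w' := expert_step eta a a' w v) :
  0 < eta -> 0 < a' -> a' <= a -> eta * enorm v <= 1 ->
  dotp v w + conjugate eta a' (level a' w') - conjugate eta a (level a w)
    + eta * enorm v ^+ 2 * enorm w' <= eta * a * enorm v ^+ 2.
Proof.
move=> eta0 a'0 aa' v1; have a0 := lt_le_trans a'0 aa'.
(* Passing from [a'] to [a] only rescales the new iterate to [W]. *)
pose W := expert_step eta a a w v.
have lW : level a W = level a' w' by rewrite /W /w' !level_step.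
have nW : enorm w' <= enorm W.
  rewrite (enorm_level w' a'0) (enorm_level W a0) lW; apply: ler_wpM2r => //.
  by rewrite subr_ge0 -expR0 ler_expR level_ge0.
apply: (@le_trans _ _ (dotp v w + conjugate eta a (level a W)
    - conjugate eta a (level a w) + eta * enorm v ^+ 2 * enorm W)).
  apply: lerD; last by rewrite ler_wpM2l // mulr_ge0 ?sqr_ge0 // ltW.
  by rewrite lerD2r lerD2l lW conjugate_le.
have D := mirror_bregman_ge w W eta0 a0.
have S := @dotp_mirror_step R d eta a a w v eta0 a0; rewrite -/W in S.
have Q := @step_quadratic R eta (enorm v) (enorm W + a) (enorm (w - W)) eta0
  (enorm_ge0 v) v1 (ltr_wpDl (enorm_ge0 W) a0) (enorm_ge0 _).
have C := dotp_le v (w - W).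
have pW : dotp (mirror eta a W) W = 2 / eta * level a W * enorm W.
  have [->|W0] := eqVneq W 0; first by rewrite dotpC dotp0l enorm0 mulr0.
  have nW0 : enorm W != 0 by rewrite enorm_eq0.
  by rewrite /mirror dotpZl -enorm_sqr; field; rewrite nW0 gt_eqF.
move: S C; rewrite !dotpDl !dotpNl dotpDr dotpNr pW => S C.
lra.
Qed.

(** * Dynamic regret of an expert *)

(** Fenchel-Young bounds the left-hand side by the regularizer at [u], which by convexity is at most
    its slope [2 / eta * level a u] times [enorm u]; the hypothesis says [level a u <= y]. *)
Lemma dotp_mirror_le (R : realType) (d : nat) (eta a y : R) (w u : 'rV[R]_d) :
  0 < eta -> 0 < a -> enorm u <= a * (expR y - 1) ->
  dotp (mirror eta a w) u - conjugate eta a (level a w) <= 2 / eta * y * enorm u.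
Proof.
move=> eta0 a0 uy.
have e2 : 0 < 2 / eta by rewrite divr_gt0.
set n := enorm u in uy *; set x := level a u; set z := level a w.
have nE : n = a * (expR x - 1) by exact: enorm_level.
have n0 : 0 <= n by exact: enorm_ge0.
have xy : x <= y.
  by rewrite -ler_expR; move: uy; rewrite nE ler_pM2l // lerD2r.
have := dotp_le (mirror eta a w) u; rewrite enorm_mirror // -/n -/z => h.
apply: (@le_trans _ _ (2 / eta * (z * n - a * (expR z - 1 - z)))).
  by rewrite /conjugate; lra.
rewrite -[2 / eta * y * n]mulrA ler_pM2l //.
apply: (@le_trans _ _ (x * n)); last by rewrite ler_wpM2r ?xy.
have k1 := expR_ge1Dx (z - x); have k2 := expR_ge1Dx x.
have k3 : expR z = expR x * expR (z - x) by rewrite -expRD; congr expR; ring.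
have k4 : expR x * (1 + (z - x)) <= expR z by rewrite k3 ler_wpM2l ?expR_ge0.
have : 0 <= a * (expR z - expR x * (1 + (z - x)) + (expR x - 1 - x)).
  by apply: mulr_ge0; [exact: ltW | lra].
by rewrite nE; lra.
Qed.

(* If [z] climbs at speed [eta / 2 * b], then climbing from [Y] to [z m]
   takes [b] of total at least [2 / eta * (z m - Y)] above level [Y];
   [b ^+ 2 >= 2 * lam * b - lam ^+ 2] replaces Cauchy-Schwarz. *)
Lemma climb_cost (R : realType) (eta lam Y : R) (z b : nat -> R) (m : nat) :
  0 < eta -> 0 <= lam -> z 0%N <= Y ->
  (forall t, (t < m)%N -> z t.+1 <= z t + eta / 2 * b t) ->
  4 * lam / eta * (z m - Y) - m%:R * lam ^+ 2 <=
    \sum_(t < m) (Y < z t.+1)%R%:R * b t ^+ 2.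
Proof.
move=> eta0 lam0 z0; have l0 : 0 <= 4 * lam / eta.
  by rewrite divr_ge0 ?mulr_ge0 // ltW.
have below y n : y <= Y -> 4 * lam / eta * (y - Y) - n%:R * lam ^+ 2 <= 0.
  move=> yY; rewrite subr_le0; apply: (@le_trans _ _ 0).
    by rewrite mulr_ge0_le0 // subr_le0.
  by rewrite mulr_ge0 ?sqr_ge0.
elim: m => [_|m IH zb]; first by rewrite big_ord0 below.
have {}IH := IH (fun t tm => zb t (leqW tm)).
have {}zb := zb m (leqnn _).
(* If [z m.+1] is not above [Y] the bound is trivial. Otherwise round [m] counts, and the induction
   hypothesis applies even when [z m <= Y], as its first term is then nonpositive. *)
rewrite big_ord_recr /=; case: ltP => [_|zY]; last first.
  apply: (le_trans (below _ _ zY)).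
  by rewrite addr_ge0 ?sumr_ge0 // => [t _|]; rewrite mulr_ge0 ?sqr_ge0.
have h : 4 * lam / eta * (z m.+1 - z m) <= 2 * lam * b m.
  apply: (@le_trans _ _ (4 * lam / eta * (eta / 2 * b m))).
    by rewrite ler_wpM2l //; lra.
  by rewrite le_eqVlt; apply/orP; left; apply/eqP; field; rewrite gt_eqF.
have k : 0 <= (b m - lam) ^+ 2 by exact: sqr_ge0.
rewrite -natr1 mul1r; lra.
Qed.

Section Expert.
Context (R : realType) (d T : nat) (eta : R) (al : nat -> R)
  (g w : nat -> 'rV[R]_d).
Hypotheses (eta0 : 0 < eta) (al0 : forall t, 0 < al t)
  (al_le : forall t, al t.+1 <= al t)
  (w0 : w 0%N = 0)
  (wS : forall t, w t.+1 = expert_step eta (al t) (al t.+1) (w t) (g t))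
  (g_le : forall t, (t < T)%N -> eta * enorm (g t) <= 1).

Lemma expert_potential :
  \sum_(t < T) dotp (g t) (w t) + conjugate eta (al T) (level (al T) (w T))
    + eta * \sum_(t < T) enorm (g t) ^+ 2 * enorm (w t.+1) <=
  eta * \sum_(t < T) al t * enorm (g t) ^+ 2.
Proof.
elim: T g_le => [_|n IH gn].
  by rewrite !big_ord0 w0 level0 /conjugate expR0 subrr subr0 !mulr0 !addr0.
have {}IH := IH (fun t tm => gn t (leqW tm)).
rewrite !big_ord_recr /=.
have := expert_step_potential (w n) eta0 (al0 n.+1) (al_le n) (gn n (leqnn _)).
rewrite -wS; lra.
Qed.

(** Up to an error of norm [2 * eta * enorm (g t) ^+ 2], [- g t] is the increment of the mirror
    gradient. Summing by parts leaves only the final boundary term, because that gradient starts at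
    [0]. *)
Lemma expert_comparator (u : nat -> 'rV[R]_d) : (0 < T)%N ->
  - \sum_(t < T) dotp (g t) (u t) <=
  2 * eta * (\sum_(t < T) enorm (g t) ^+ 2 * enorm (u t))
  + dotp (mirror eta (al T) (w T)) (u T.-1)
  - \sum_(1 <= t < T) dotp (mirror eta (al t) (w t)) (u t - u t.-1).
Proof.
have step t : - dotp (g t) (u t) <=
    dotp (mirror eta (al t.+1) (w t.+1)) (u t)
    - dotp (mirror eta (al t) (w t)) (u t)
    + 2 * eta * (enorm (g t) ^+ 2 * enorm (u t)).
  have h := mirror_step_close (al t) (w t) (g t) eta0 (al0 t.+1).
  rewrite -wS in h.
  have := dotp_le (mirror eta (al t) (w t) - g t - mirror eta (al t.+1) (w t.+1)) (u t).
  rewrite !dotpDl !dotpNl => k.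
  have := ler_wpM2r (enorm_ge0 (u t)) h.
  by lra.
case: T => // n _; elim: n => [|n IH].
  rewrite !big_ord_recr !big_ord0 /= big_geq //.
  have := step 0%N; rewrite w0 {2}/mirror scaler0 dotp0l; lra.
rewrite big_ord_recr [X in 2 * eta * X]big_ord_recr big_nat_recr //=.
have := step n.+1; rewrite dotpDr dotpNr /= in IH *; lra.
Qed.

Lemma level_rec (t : nat) :
  level (al t.+1) (w t.+1) <= level (al t) (w t) + eta / 2 * enorm (g t).
Proof. by rewrite wS level_step_le. Qed.

Lemma al_noninc (m n : nat) : (m <= n)%N -> al n <= al m.
Proof. by move=> mn; exact: (homo_leq (r := fun x y : R => y <= x) lexx
  (fun _ _ _ h k => le_trans k h) al_le). Qed.

(* When the levels exceed [2 * L], the negative term accumulated during the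
   climb pays for the path-length term. *)
Lemma expert_path (M L : R) (u : nat -> 'rV[R]_d) : (0 < T)%N ->
  (forall t, (t < T)%N -> enorm (u t) <= M) -> 1 <= L ->
  M * T%:R ^+ 2 <= al T * (expR L - 1) ->
  - \sum_(1 <= t < T) dotp (mirror eta (al t) (w t)) (u t - u t.-1) <=
  4 / eta * path_length T u * L
  + eta * \sum_(t < T) enorm (g t) ^+ 2 * enorm (w t.+1).
Proof.
move=> T0 uM L1 ML; set z := fun t => level (al t) (w t).
have z0 t : 0 <= z t by exact: level_ge0.
have M0 : 0 <= M by apply: le_trans (uM 0%N T0); exact: enorm_ge0.
have P0 : 0 <= path_length T u by rewrite sumr_ge0 // => t _; exact: enorm_ge0.
have PM : path_length T u <= 2 * M * T%:R.
  apply: (@le_trans _ _ (\sum_(1 <= t < T) 2 * M)).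
    rewrite /path_length !big_nat; apply: ler_sum => t /andP[t0 tT].
    apply: (le_trans (enormB _ _)); have := uM t tT.
    have := uM t.-1 (leq_ltn_trans (leq_pred t) tT); lra.
  rewrite sumr_const_nat -[_ *+ _]mulr_natr ler_wpM2l ?mulr_ge0 //.
  by rewrite ler_nat leq_subr.
have [m _ mmax] := @arg_maxP _ _ 'I_T (Ordinal T0) xpredT (fun i => z i) isT.
set Z := z m.
have S0 : 0 <= \sum_(t < T) enorm (g t) ^+ 2 * enorm (w t.+1).
  by rewrite sumr_ge0 // => t _; rewrite mulr_ge0 ?sqr_ge0 ?enorm_ge0.
have sumZ : - \sum_(1 <= t < T) dotp (mirror eta (al t) (w t)) (u t - u t.-1)
    <= 2 / eta * Z * path_length T u.
  rewrite /path_length -sumrN mulr_sumr !big_nat.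
  apply: ler_sum => t /andP[t0 tT].
  have := dotp_geN (mirror eta (al t) (w t)) (u t - u t.-1).
  rewrite enorm_mirror // lerNl => /le_trans; apply.
  rewrite ler_wpM2r ?enorm_ge0 // ler_wpM2l //; first by rewrite divr_ge0 // ltW.
  exact: (mmax (Ordinal tT)).
apply: (le_trans sumZ).
have [ZL|LZ] := leP Z (2 * L).
  apply: (@le_trans _ _ (4 / eta * path_length T u * L)); last first.
    by rewrite lerDl mulr_ge0 // ltW.
  have -> : 4 / eta * path_length T u * L = 2 / eta * (2 * L) * path_length T u.
    by ring.
  by rewrite ler_wpM2r // ler_wpM2l // divr_ge0 // ltW.
pose x := Z - 2 * L.
have Tp : 0 < T%:R :> R by rewrite ltr0n.
have x0 : 0 <= x by rewrite subr_ge0 ltW.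
(* Since [1 <= L], [Z - 1 >= L + x]; the factor [expR x] then dominates the excess [x]. *)
have alT : al T * (expR (Z - 1) - 1) >= x * (M * T%:R ^+ 2).
  apply: (@le_trans _ _ (x * (al T * (expR L - 1)))); first by rewrite ler_wpM2l.
  rewrite mulrCA ler_pM2l //.
  have k1 : expR (L + x) <= expR (Z - 1) by rewrite ler_expR /x; lra.
  have k2 : 1 <= expR x by rewrite -expR0 ler_expR.
  have k3 : x * (expR L - 1) <= expR x * (expR L - 1).
    rewrite ler_wpM2r //; first by rewrite subr_ge0 -expR0 ler_expR; lra.
    by have := expR_ge1Dx x; lra.
  by rewrite expRD in k1; lra.
have z00 : z 0%N <= Z - 1 by rewrite /z w0 level0; lra.
(* [2 / (eta * T)] maximizes [4 * lam / eta - T * lam ^+ 2], with value [4 / (eta ^+ 2 * T)]. *)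
have lam0 : 0 <= 2 / (eta * T%:R) by rewrite divr_ge0 // mulr_ge0 // ltW.
have := @climb_cost R eta _ (Z - 1) z (fun t => enorm (g t)) m eta0 lam0 z00
  (fun t _ => level_rec t).
set C := \sum_(t < m) _ => hC.
have C4 : 4 / (eta ^+ 2 * T%:R) <= C.
  apply: le_trans hC; rewrite -/Z.
  have mT : m%:R <= T%:R :> R by rewrite ler_nat ltnW.
  apply: (@le_trans _ _ (4 * (2 / (eta * T%:R)) / eta * (Z - (Z - 1)) -
      T%:R * (2 / (eta * T%:R)) ^+ 2)).
    rewrite le_eqVlt; apply/orP; left; apply/eqP.
    by field; rewrite !gt_eqF.
  by rewrite lerD2l lerN2 ler_wpM2r // sqr_ge0.
(* A round counted in [C] ends above level [Z - 1], and [al t.+1 >= al T], so its iterate has norm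
   at least [al T * (expR (Z - 1) - 1)]. *)
have SC : al T * (expR (Z - 1) - 1) * C <=
    \sum_(t < T) enorm (g t) ^+ 2 * enorm (w t.+1).
  rewrite /C mulr_sumr (big_ord_widen T (fun t => al T * (expR (Z - 1) - 1) *
    ((Z - 1 < z t.+1)%R%:R * enorm (g t) ^+ 2)) (ltnW (ltn_ord m))) big_mkcond /=.
  apply: ler_sum => t _; case: ifP => _; last first.
    by rewrite mulr_ge0 ?sqr_ge0 ?enorm_ge0.
  case: ltP => [zt|_]; last first.
    by rewrite mul0r mulr0 mulr_ge0 ?sqr_ge0 ?enorm_ge0.
  rewrite mul1r mulrC ler_wpM2l ?sqr_ge0 //.
  rewrite (enorm_level (w t.+1) (al0 t.+1)).
  apply: ler_pM; rewrite ?(ltW (al0 _)) ?al_noninc //; last first.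
    by rewrite lerD2r ler_expR ltW.
  by have := expR_ge1Dx (Z - 1); lra.
have K : x * (M * T%:R ^+ 2) * (4 / (eta ^+ 2 * T%:R)) <=
    \sum_(t < T) enorm (g t) ^+ 2 * enorm (w t.+1).
  apply: le_trans SC; apply: ler_pM => //.
    by rewrite mulr_ge0 // mulr_ge0 // sqr_ge0.
  by rewrite divr_ge0 // mulr_ge0 // sqr_ge0.
have := ler_wpM2l (ltW eta0) K.
have -> : eta * (x * (M * T%:R ^+ 2) * (4 / (eta ^+ 2 * T%:R))) =
    2 / eta * x * (2 * M * T%:R).
  by field; rewrite !gt_eqF.
move=> {}K.
have : 2 / eta * x * path_length T u <= 2 / eta * x * (2 * M * T%:R).
  by rewrite ler_wpM2l // mulr_ge0 // divr_ge0 // ltW.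
have -> : Z = 2 * L + x by rewrite /x; ring.
lra.
Qed.

Lemma expert_regret0 :
  \sum_(t < T) dotp (g t) (w t) <= eta * \sum_(t < T) al t * enorm (g t) ^+ 2.
Proof.
apply: le_trans expert_potential; rewrite -addrA lerDl addr_ge0 //.
  exact: conjugate_ge0.
rewrite mulr_ge0 ?(ltW eta0) // sumr_ge0 // => t _.
by rewrite mulr_ge0 ?sqr_ge0 ?enorm_ge0.
Qed.

(** The gain in [expert_potential] cancels the last term of [expert_path], and its final conjugate
    absorbs the boundary term of [expert_comparator], at the cost of the summand [M]. *)
Lemma expert_regret (M L : R) (u : nat -> 'rV[R]_d) : (0 < T)%N ->
  (forall t, (t < T)%N -> enorm (u t) <= M) -> 1 <= L ->
  M * T%:R ^+ 2 <= al T * (expR L - 1) ->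
  \sum_(t < T) dotp (g t) (w t - u t) <=
    4 / eta * ((M + path_length T u) * L)
    + 2 * eta * (\sum_(t < T) enorm (g t) ^+ 2 * enorm (u t))
    + eta * \sum_(t < T) al t * enorm (g t) ^+ 2.
Proof.
move=> T0 uM L1 ML.
have uT := uM T.-1 _; rewrite prednK // leqnn in uT; have {}uT := uT isT.
have M0 : 0 <= M by apply: le_trans uT; exact: enorm_ge0.
have -> : \sum_(t < T) dotp (g t) (w t - u t) =
    \sum_(t < T) dotp (g t) (w t) - \sum_(t < T) dotp (g t) (u t).
  by rewrite -sumrB; apply: eq_bigr => t _; rewrite dotpDr dotpNr.
have h1 := expert_potential.
have h2 := expert_comparator u T0.
have h3 := expert_path T0 uM L1 ML.
have uL : enorm (u T.-1) <= al T * (expR L - 1).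
  apply: le_trans ML; apply: (le_trans uT); rewrite ler_peMr //.
  by rewrite exprn_ege1 // ler1n.
have h4 := dotp_mirror_le (w T) eta0 (al0 T) uL.
have h5 : 2 / eta * L * enorm (u T.-1) <= 4 / eta * (M * L).
  have -> : 4 / eta * (M * L) = 2 / eta * L * (2 * M) by ring.
  rewrite ler_wpM2l //; last by lra.
  by rewrite mulr_ge0 ?divr_ge0 ?ltW //; lra.
lra.
Qed.

End Expert.

(** * The grid of step sizes *)

(** Test the subgradient inequality at [x + v]. *)
Lemma subgradient_enorm (R : realType) (d : nat) (G : R)
    (f : 'rV[R]_d -> R) (x v : 'rV[R]_d) :
  0 <= G -> elipschitz G f -> subgradient f x v -> enorm v <= G.
Proof.
move=> G0 fG fv; have [->|v0] := eqVneq v 0; first by rewrite enorm0.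
have vp : 0 < enorm v by rewrite lt0r enorm_eq0 v0 enorm_ge0.
have := fv (x + v); have := ler_norm (f (x + v) - f x); have := fG (x + v) x.
rewrite addrAC subrr add0r -enorm_sqr => h1 h2 h3.
by rewrite -(ler_pM2r vp); lra.
Qed.

Lemma ln2_ge (R : realType) : 1 / 2 <= ln 2 :> R.
Proof.
have := @le_ln1Dx R (- (1 / 2)); rewrite ltrN2.
have -> : 1 + - (1 / 2) = 2^-1 :> R by field.
by rewrite lnV ?posrE // => h; have := h _; lra.
Qed.

Lemma ln4_ge1 (R : realType) : 1 <= ln 4 :> R.
Proof.
have -> : 4 = 2 ^+ 2 :> R by ring.
by rewrite lnXn // mulr2n; have := ln2_ge R; lra.
Qed.

(** The initial value [4 * G ^+ 2] of [Vseq] keeps all ratios to [G ^+ 2] at least [4], hence all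
    logarithms in [alpha] at least [1]. *)
Lemma ln_ge4 (R : realType) (v : R) : 4 <= v -> 1 <= ln v.
Proof.
by move=> v4; apply: (le_trans (ln4_ge1 R)); rewrite ler_ln ?posrE //; lra.
Qed.

(* A discrete version of [\int dv / (v ln^2 v) = - 1 / ln v]. *)
Lemma log_increment (R : realType) (v x : R) : 4 <= v -> 0 <= x <= 1 ->
  x / (v * ln v ^+ 2) <= 2 * ((ln v)^-1 - (ln (v + x))^-1).
Proof.
move=> v4 /andP[x0 x1].
have v0 : 0 < v by lra.
have vx0 : 0 < v + x by lra.
have a1 := ln_ge4 v4.
have b1 : 1 <= ln (v + x) by apply: ln_ge4; lra.
have up : ln (v + x) <= ln v + x / v.
  have -> : v + x = v * (1 + x / v) by field; rewrite gt_eqF.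
  have q0 : 0 <= x / v by rewrite divr_ge0 // ltW.
  rewrite lnM ?posrE //; last by lra.
  by rewrite lerD2l le_ln1Dx //; lra.
have low : ln v + x / (v + x) <= ln (v + x).
  have -> : ln v = ln (v + x) + ln (1 + - (x / (v + x))).
    rewrite -lnM ?posrE //; first by congr ln; field; rewrite gt_eqF.
    by rewrite subr_gt0 ltr_pdivrMr //; lra.
  have : -1 < - (x / (v + x)) by rewrite ltrN2 ltr_pdivrMr //; lra.
  by move/(@le_ln1Dx R); lra.
set a := ln v in a1 up low *; set b := ln (v + x) in b1 up low *.
have xv : x / v <= 1 / 4 by rewrite ler_pdivrMr //; lra.
have low' : 4 / 5 * (x / v) <= x / (v + x).
  rewrite ler_pdivlMr //.
  have -> : 4 / 5 * (x / v) * (v + x) = 4 / 5 * x * (v + x) / v.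
    by field; rewrite gt_eqF.
  rewrite ler_pdivrMr //.
  have : 0 <= x * (v - 4 * x) by rewrite mulr_ge0 //; lra.
  by lra.
have a0 : 0 < a by lra.
have b0 : 0 < b by lra.
have -> : a^-1 - b^-1 = (b - a) / (a * b) by field; rewrite !gt_eqF.
have -> : x / (v * a ^+ 2) = x / v / a ^+ 2 by field; rewrite !gt_eqF.
rewrite ler_pdivrMr ?exprn_gt0 //.
have -> : 2 * ((b - a) / (a * b)) * a ^+ 2 = 2 * (b - a) * a ^+ 2 / (a * b).
  by field; rewrite !gt_eqF.
rewrite ler_pdivlMr ?mulr_gt0 //.
have q0 : 0 <= x / v by rewrite divr_ge0 // ltW.
set q := x / v in q0 xv up low' *.
(* The factor [2] of the statement covers the loss [(5 / 4) / (4 / 5) = 25 / 16]. *)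
have ba : b <= 5 / 4 * a by lra.
have : q * (a * b) <= q * (a * (5 / 4 * a)) by rewrite ler_wpM2l // ler_pM2l.
have : (4 / 5 * q) * a ^+ 2 <= (b - a) * a ^+ 2.
  by rewrite ler_wpM2r ?sqr_ge0 //; lra.
have : 0 <= q * a ^+ 2 by rewrite mulr_ge0 ?sqr_ge0.
by lra.
Qed.

Lemma VseqE (R : realType) (d : nat) (G : R) (g : nat -> 'rV[R]_d) (t : nat) :
  0 < G ->
  Vseq G g t / G ^+ 2 = 4 + (\sum_(s < t) enorm (g s) ^+ 2) / G ^+ 2.
Proof.
move=> G0; have -> : Vseq G g t = 4 * G ^+ 2 + \sum_(s < t) enorm (g s) ^+ 2.
  elim: t => [|t IH]; first by rewrite big_ord0 addr0.
  by rewrite big_ord_recr /= IH addrA.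
by field; rewrite gt_eqF.
Qed.

Section Learner.
Context (R : realType) (d T : nat) (G eps : R) (g : nat -> 'rV[R]_d).
Hypotheses (T2 : (2 <= T)%N) (G0 : 0 < G) (eps0 : 0 < eps)
  (gG : forall t, (t < T)%N -> enorm (g t) <= G).
Let N := size (grid G T).
Let K := grid_count R T.
Let q t := Vseq G g t / G ^+ 2.

Let T0 : 0 < T%:R :> R.
Proof. by rewrite ltr0n ltnW. Qed.

Let sqT0 : 0 < Num.sqrt (T%:R : R).
Proof. by rewrite sqrtr_gt0. Qed.

Let ln_sqrtT : ln (Num.sqrt (T%:R : R)) = ln (T%:R) / 2.
Proof.
have -> : ln (T%:R : R) = ln (Num.sqrt (T%:R : R) ^+ 2).
  by rewrite sqr_sqrtr // ltW.
by rewrite lnXn // mulr2n; lra.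
Qed.

Let ln2_gt0 : 0 < ln 2 :> R.
Proof. by apply: lt_le_trans (ln2_ge R). Qed.

Let lnT : ln 2 <= ln (T%:R) :> R.
Proof. by rewrite ler_ln ?posrE // ler_nat. Qed.

Let KE : K%:R = (Num.ceil (ln (Num.sqrt (T%:R : R)) / ln 2))%:~R :> R.
Proof.
rewrite /K /grid_count -[LHS]/((_ : nat)%:Z%:~R) gez0_abs // ceil_ge0.
apply: (@lt_le_trans _ _ 0) => //.
by rewrite divr_ge0 ?ltW // ln_sqrtT divr_gt0 // (lt_le_trans ln2_gt0).
Qed.

Let K_ge : ln (Num.sqrt (T%:R : R)) <= K%:R * ln 2.
Proof. by rewrite -ler_pdivrMr // KE ceil_ge. Qed.

Let K_le : K%:R <= ln (T%:R) / 2 / ln 2 + 1 :> R.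
Proof.
rewrite KE -ln_sqrtT -lerBlDr; apply: ltW.
by have /andP[] := ceil_itv (ln (Num.sqrt (T%:R : R)) / ln 2); rewrite intrD.
Qed.

Let K_gt0 : (0 < K)%N.
Proof.
rewrite -(ltr0n R) -(pmulr_lgt0 _ ln2_gt0); apply: lt_le_trans K_ge.
by rewrite ln_sqrtT divr_gt0 // (lt_le_trans ln2_gt0).
Qed.

Let sqT_le : Num.sqrt (T%:R : R) <= 2 ^+ K.
Proof.
by rewrite -ler_ln ?posrE ?exprn_gt0 // lnXn // -[leRHS]mulr_natl.
Qed.

Let step k : R := Num.min (2 ^+ k / (G * Num.sqrt T%:R)) G^-1.

Let mem_step k : (0 < k <= K)%N -> step k \in grid G T.
Proof.
move=> /andP[k0 kK]; rewrite mem_undup; apply: map_f.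
by rewrite mem_iota k0 add1n ltnS.
Qed.

Lemma grid_itv (eta : R) : eta \in grid G T -> 0 < eta <= G^-1.
Proof.
rewrite mem_undup => /mapP[k _ ->].
by rewrite lt_min ge_min lexx orbT invr_gt0 G0 divr_gt0 ?exprn_gt0 // mulr_gt0.
Qed.

(** [2 ^+ K] reaches [Num.sqrt T], so the minimum is capped. *)
Let step_last : step K = G^-1.
Proof.
apply/min_idPr; rewrite ler_pdivlMr ?mulr_gt0 // mulKf // gt_eqF //.
Qed.

Lemma inv_in_grid : G^-1 \in grid G T.
Proof. by rewrite -step_last mem_step // K_gt0 leqnn. Qed.

Lemma size_grid_gt0 : (0 < size (grid G T))%N.
Proof. by case: (grid G T) inv_in_grid. Qed.

(** The inequality has the useful direction: fewer experts make [alpha] larger. *)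
Lemma size_grid_le : (size (grid G T) <= grid_count R T)%N.
Proof. by apply: (leq_trans (size_undup _)); rewrite size_map size_iota. Qed.

Let q_ge4 t : 4 <= q t.
Proof.
by rewrite /q VseqE // lerDl divr_ge0 ?sqr_ge0 // sumr_ge0 // => s _; exact: sqr_ge0.
Qed.

Let qS t : q t.+1 = q t + enorm (g t) ^+ 2 / G ^+ 2.
Proof. by rewrite /q /= mulrDl. Qed.

Let N0 : 0 < N%:R :> R.
Proof. by rewrite ltr0n size_grid_gt0. Qed.

Lemma alphaE t : alpha G eps T g t = eps / N%:R / (q t * ln (q t) ^+ 2).
Proof.
have l0 := lt_le_trans ltr01 (ln_ge4 (q_ge4 t)).
have q0 : 0 < q t by apply: lt_le_trans (q_ge4 t).
have V0 : Vseq G g t = q t * G ^+ 2 by rewrite /q divfK // expf_eq0 gt_eqF.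
rewrite /alpha -/(q t) -/N V0.
by field; rewrite !gt_eqF.
Qed.

Lemma alpha_gt0 t : 0 < alpha G eps T g t.
Proof.
have l0 := lt_le_trans ltr01 (ln_ge4 (q_ge4 t)).
have q0 : 0 < q t by apply: lt_le_trans (q_ge4 t).
by rewrite alphaE !divr_gt0 // mulr_gt0 // exprn_gt0.
Qed.

Lemma alpha_noninc t : alpha G eps T g t.+1 <= alpha G eps T g t.
Proof.
have l0 := lt_le_trans ltr01 (ln_ge4 (q_ge4 t)).
have q0 : 0 < q t by apply: lt_le_trans (q_ge4 t).
have qq : q t <= q t.+1 by rewrite qS lerDl divr_ge0 ?sqr_ge0.
rewrite !alphaE ler_pM2l ?divr_gt0 // lef_pV2 ?posrE.
- apply: ler_pM; rewrite ?sqr_ge0 ?(ltW q0) //.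
  rewrite ler_pXn2r ?nnegrE ?(ltW l0) //.
    by rewrite ler_ln ?posrE // (lt_le_trans q0).
  by rewrite (le_trans ler01) // ln_ge4.
- rewrite mulr_gt0 ?(lt_le_trans q0 qq) // exprn_gt0 //.
  by rewrite (lt_le_trans ltr01) // ln_ge4.
- by rewrite mulr_gt0 // exprn_gt0.
Qed.

(** With [x = enorm (g t) ^+ 2 / G ^+ 2], [log_increment] telescopes to at most [1 / ln (q 0) <= 1];
    [eta <= G^-1] removes one factor [G]. *)
Lemma sum_alpha (eta : R) : 0 < eta <= G^-1 ->
  eta * \sum_(t < T) alpha G eps T g t * enorm (g t) ^+ 2 <=
    2 * eps * G / N%:R.
Proof.
move=> /andP[eta0 etaG].
have partial n : (n <= T)%N ->
    \sum_(t < n) alpha G eps T g t * enorm (g t) ^+ 2 <=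
    2 * (eps / N%:R) * G ^+ 2 * ((ln (q 0%N))^-1 - (ln (q n))^-1).
  elim: n => [_|n IH nT]; first by rewrite big_ord0 subrr mulr0.
  rewrite big_ord_recr /=; have {}IH := IH (ltnW nT).
  have x1 : 0 <= enorm (g n) ^+ 2 / G ^+ 2 <= 1.
    rewrite divr_ge0 ?sqr_ge0 //= ler_pdivrMr ?exprn_gt0 // mul1r.
    by rewrite ler_pXn2r ?nnegrE ?enorm_ge0 ?gG // ltW.
  have := log_increment (q_ge4 n) x1; rewrite -qS.
  have c0 : 0 <= eps / N%:R * G ^+ 2.
    by rewrite mulr_ge0 ?sqr_ge0 // divr_ge0 // ltW.
  move/(ler_wpM2l c0).
  have -> : eps / N%:R * G ^+ 2 *
      (enorm (g n) ^+ 2 / G ^+ 2 / (q n * ln (q n) ^+ 2)) =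
      alpha G eps T g n * enorm (g n) ^+ 2.
    have l0 := lt_le_trans ltr01 (ln_ge4 (q_ge4 n)).
    have q0 : 0 < q n by apply: lt_le_trans (q_ge4 n).
    by rewrite alphaE; field; rewrite !gt_eqF.
  by lra.
have c0 : 0 <= 2 * (eps / N%:R) * G ^+ 2.
  by rewrite mulr_ge0 ?sqr_ge0 // mulr_ge0 // divr_ge0 // ltW.
have d1 : (ln (q 0%N))^-1 - (ln (q T))^-1 <= 1.
  have a1 := ln_ge4 (q_ge4 0); have b1 := ln_ge4 (q_ge4 T).
  have : (ln (q 0%N))^-1 <= 1 by rewrite invf_le1 // (lt_le_trans ltr01).
  have : 0 <= (ln (q T))^-1 by rewrite invr_ge0 (le_trans ler01).
  by lra.
have h := le_trans (partial T (leqnn T)) (ler_wpM2l c0 d1).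
apply: (@le_trans _ _ (G^-1 * (2 * (eps / N%:R) * G ^+ 2 * 1))); last first.
  by rewrite le_eqVlt; apply/orP; left; apply/eqP; field; rewrite !gt_eqF.
apply: ler_pM => //; first exact: ltW.
by rewrite sumr_ge0 // => t _; rewrite mulr_ge0 ?sqr_ge0 // ltW // alpha_gt0.
Qed.

Let LambdaE : Lambda G T g = T%:R ^+ 2 * q T * ln (q T) ^+ 2 * K%:R.
Proof. by rewrite /q VseqE. Qed.

Lemma log_factor_ge1 (u : nat -> 'rV[R]_d) : 1 <= log_factor G eps T g u.
Proof. by rewrite le_max lexx orbT. Qed.

Lemma max_norm_ge0 (u : nat -> 'rV[R]_d) : 0 <= max_norm T u.
Proof.
rewrite /max_norm; elim/big_ind: _ => // [x y x0 y0|t _]; last exact: enorm_ge0.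
by rewrite le_max x0.
Qed.

(** [Lambda] is built so that [alpha] at time [T] times [Lambda] is [eps * T ^+ 2 * K / N], with
    [K / N >= 1]; the factor [9 / 4] is slack. *)
Lemma alpha_log_factor (u : nat -> 'rV[R]_d) :
  max_norm T u * T%:R ^+ 2 <=
    alpha G eps T g T * (expR (log_factor G eps T g u) - 1).
Proof.
have l0 := lt_le_trans ltr01 (ln_ge4 (q_ge4 T)).
have q0 : 0 < q T by apply: lt_le_trans (q_ge4 T).
have M0 := max_norm_ge0 u.
have L0 : 0 <= 9 * max_norm T u * Lambda G T g / (4 * eps).
  apply: divr_ge0; last by rewrite mulr_ge0 // ltW.
  rewrite LambdaE; apply: mulr_ge0; first by rewrite mulr_ge0.
  apply: mulr_ge0 => //; apply: mulr_ge0; last exact: sqr_ge0.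
  by apply: mulr_ge0; [exact: sqr_ge0 | exact: ltW].
have h : 9 * max_norm T u * Lambda G T g / (4 * eps) + 1 <=
    expR (log_factor G eps T g u).
  rewrite /log_factor; set y := (X in ln X).
  have y0 : 0 < y by apply: ltr_wpDl.
  by rewrite -[leLHS](lnK y0) ler_expR le_max lexx.
apply: (@le_trans _ _ (alpha G eps T g T *
    (9 * max_norm T u * Lambda G T g / (4 * eps)))); last first.
  by rewrite ler_wpM2l ?(ltW (alpha_gt0 T)) //; lra.
rewrite LambdaE alphaE.
have -> : eps / N%:R / (q T * ln (q T) ^+ 2) *
    (9 * max_norm T u * (T%:R ^+ 2 * q T * ln (q T) ^+ 2 * K%:R) / (4 * eps)) =
    max_norm T u * T%:R ^+ 2 * (9 / 4 * (K%:R / N%:R)).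
  by field; rewrite !gt_eqF.
rewrite ler_peMr ?mulr_ge0 ?sqr_ge0 //.
have : 1 <= K%:R / N%:R :> R by rewrite ler_pdivlMr // mul1r ler_nat size_grid_le.
by lra.
Qed.

(* The sum is minimized at [eta ^+ 2 = 2 * X / W]; the grid contains a point
   at most twice larger, unless [G^-1] is already smaller than that. *)
Lemma grid_tuning (X W : R) : 0 <= X -> 0 <= W -> W <= G ^+ 2 * T%:R * X ->
  exists2 eta, eta \in grid G T &
    4 / eta * X + 2 * eta * W <= 6 * Num.sqrt (2 * X * W) + 4 * G * X.
Proof.
move=> X0 W0 WX; set S := Num.sqrt _.
have S0 : 0 <= S by exact: sqrtr_ge0.
have S2 : S ^+ 2 = 2 * X * W by rewrite sqr_sqrtr // !mulr_ge0.
have le_S (y c : R) : 0 <= y -> 0 <= c -> y ^+ 2 <= c ^+ 2 * (2 * X * W) -> y <= c * S.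
  move=> y0 c0 h; rewrite -(@ler_pXn2r _ 2) ?nnegrE ?mulr_ge0 //.
  by rewrite exprMn S2.
(* If [G^-1] is below the optimum it is the choice, and its first term is the additive
   [4 * G * X]. *)
have [small|large] := leP (G^-1 ^+ 2 * W) (2 * X).
  exists G^-1; first exact: inv_in_grid.
  have : 2 * G^-1 * W <= 2 * S.
    apply: le_S; rewrite ?mulr_ge0 ?invr_ge0 ?(ltW G0) //.
    have := ler_wpM2r W0 small; lra.
  have -> : 4 / G^-1 * X = 4 * G * X by rewrite invrK.
  lra.
(* Otherwise take the least grid index whose step reaches the optimum. *)
pose good k := (0 < k <= K)%N && (2 * X <= step k ^+ 2 * W).
have exg : exists k, good k.
  by exists K; rewrite /good K_gt0 leqnn step_last ltW.
case: (ex_minnP exg) => k /andP[kK gk] kmin.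
exists (step k); first exact: mem_step.
have W1 : 0 < W.
  rewrite lt_neqAle W0 andbT; apply/eqP => W00.
  by move: large; rewrite -W00 mulr0; lra.
have /andP[s0 _] := grid_itv (mem_step kK).
(* The first grid point is small enough by the assumption on [W]; any later one is at most twice its
   predecessor, which by minimality lies below the optimum. *)
have up : step k ^+ 2 * W <= 8 * X.
  case: k kK gk kmin s0 => [//|[|k]] /andP[_ kK] gk kmin s0.
    apply: (@le_trans _ _ ((2 / (G * Num.sqrt T%:R)) ^+ 2 * (G ^+ 2 * T%:R * X))).
      apply: ler_pM; rewrite ?sqr_ge0 //.
      rewrite ler_pXn2r ?nnegrE ?(ltW s0) //; first by rewrite /step ge_min expr1 lexx.
      by rewrite divr_ge0 // mulr_ge0 // ltW.
    have -> : (2 / (G * Num.sqrt T%:R)) ^+ 2 * (G ^+ 2 * T%:R * X) = 4 * X.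
      move: (sqr_sqrtr (ltW T0)) sqT0; set s := Num.sqrt _ => <- sp.
      by field; rewrite !gt_eqF.
    by lra.
  have kK1 : (0 < k.+1 <= K)%N by exact: ltnW.
  have /andP[s1 _] := grid_itv (mem_step kK1).
  have nk : step k.+1 ^+ 2 * W < 2 * X.
    rewrite ltNge; apply/negP => h.
    by have := kmin k.+1; rewrite /good kK1 h ltnn => /(_ isT).
  have s2 : step k.+2 <= 2 * step k.+1.
    rewrite /step minr_pMr // ge_min !le_min exprS -!mulrA lexx /=.
    have g2 : G^-1 <= 2 * G^-1 by rewrite ler_peMl // ?invr_ge0 ?ltW //; lra.
    rewrite g2 andbT.
    by case: leP => //= h; apply: le_trans g2 (ltW h).
  have : step k.+2 ^+ 2 <= (2 * step k.+1) ^+ 2.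
    by rewrite ler_pXn2r ?nnegrE ?mulr_ge0 ?(ltW s0) ?(ltW s1).
  by move/(ler_wpM2r W0); lra.
(* The lower bound [gk] controls the first term and the upper bound [up] the second: [2 + 4] gives
   the constant [6]. *)
have h1 : 4 / step k * X <= 2 * S.
  apply: le_S; rewrite ?mulr_ge0 ?invr_ge0 ?(ltW s0) //.
  have -> : (4 / step k * X) ^+ 2 = 16 * X ^+ 2 / step k ^+ 2.
    by field; rewrite gt_eqF.
  rewrite ler_pdivrMr ?exprn_gt0 //.
  have := ler_wpM2l X0 gk; lra.
have h2 : 2 * step k * W <= 4 * S.
  apply: le_S; rewrite ?mulr_ge0 ?(ltW s0) //.
  have := ler_wpM2r W0 up; lra.
have : 0 <= 4 * G * X by rewrite !mulr_ge0 // ltW.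
by lra.
Qed.

(** * Regret of the sum of the experts *)

Let expert_t eta := expert G eps T g eta.

(** Since the played point is the sum of the iterates, the tuned expert is charged with the whole
    comparator and the others with [0]; the [N] terms [2 * eps * G / N] add up to [2 * eps * G]. *)
Lemma play_regret (u : nat -> 'rV[R]_d) (M := max_norm T u)
    (P := path_length T u) (L := log_factor G eps T g u) :
  \sum_(t < T) dotp (g t) (play G eps T g t - u t) <=
    2 * eps * G
    + 6 * Num.sqrt (2 * (M + P) * L *
                    \sum_(t < T) enorm (g t) ^+ 2 * enorm (u t))
    + 4 * G * (M + P) * L.
Proof.
set W := \sum_(t < T) enorm (g t) ^+ 2 * enorm (u t).
have uM t : (t < T)%N -> enorm (u t) <= M.
  move=> tT; exact: (le_bigmax 0 (fun i : 'I_T => enorm (u i)) (Ordinal tT)).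
have M0 : 0 <= M := max_norm_ge0 u.
have P0 : 0 <= P by rewrite /P sumr_ge0 // => t _; exact: enorm_ge0.
have L1 : 1 <= L := log_factor_ge1 u.
pose X := (M + P) * L.
have MX : M <= X.
  apply: (@le_trans _ _ (M + P)); first by rewrite lerDl.
  by rewrite ler_peMr // addr_ge0.
have X0 : 0 <= X by exact: le_trans MX.
have W0 : 0 <= W.
  by rewrite sumr_ge0 // => t _; rewrite mulr_ge0 ?sqr_ge0 ?enorm_ge0.
(* This is the hypothesis of [grid_tuning] that handles the smallest step size. *)
have WX : W <= G ^+ 2 * T%:R * X.
  apply: (@le_trans _ _ (\sum_(t < T) G ^+ 2 * X)).
    apply: ler_sum => t _; apply: ler_pM; rewrite ?sqr_ge0 ?enorm_ge0 //.
      by rewrite ler_pXn2r ?nnegrE ?enorm_ge0 ?gG // ltW.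
    by apply: le_trans MX; exact: uM.
  by rewrite sumr_const card_ord -[_ *+ _]mulr_natr mulrAC.
have [eta etaS tune] := grid_tuning X0 W0 WX.
have Teq t : dotp (g t) (play G eps T g t - u t) =
    \sum_(i <- grid G T) dotp (g t) (expert_t i t) - dotp (g t) (u t).
  rewrite dotpDr dotpNr dotpC dotp_suml; congr (_ - _).
  by apply: eq_bigr => i _; rewrite dotpC.
under eq_bigr do rewrite Teq.
rewrite sumrB exchange_big /=.
have g1 i : i \in grid G T -> forall t, (t < T)%N -> i * enorm (g t) <= 1.
  move=> /grid_itv/andP[i0 iG] t tT.
  rewrite -(mulVf (lt0r_neq0 G0)); apply: ler_pM; rewrite ?enorm_ge0 ?gG //.
  exact: ltW.
have b i : i \in grid G T ->
    \sum_(t < T) dotp (g t) (expert_t i t) <= 2 * eps * G / N%:R.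
  move=> iS; have /andP[i0 _] := grid_itv iS.
  apply: le_trans (sum_alpha (grid_itv iS)).
  exact: (@expert_regret0 R d T i (alpha G eps T g) g (expert_t i) i0 alpha_gt0
    alpha_noninc erefl (fun=> erefl) (g1 i iS)).
have /andP[eta0 _] := grid_itv etaS.
have := @expert_regret R d T eta (alpha G eps T g) g (expert_t eta) eta0 alpha_gt0
  alpha_noninc erefl (fun=> erefl) (g1 _ etaS) M L u (ltnW T2) uM L1
  (alpha_log_factor u).
have -> : \sum_(t < T) dotp (g t) (expert_t eta t - u t) =
    \sum_(t < T) dotp (g t) (expert_t eta t) - \sum_(t < T) dotp (g t) (u t).
  by rewrite -sumrB; apply: eq_bigr => t _; rewrite dotpDr dotpNr.
rewrite -/P -/X -/W => reg.
have := sum_alpha (grid_itv etaS).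
have all : \sum_(i <- grid G T) (2 * eps * G / N%:R) = 2 * eps * G.
  rewrite big_const_seq count_predT iter_addr addr0 -/N.
  by rewrite -[_ *+ _]mulr_natr divfK // gt_eqF.
have uS : uniq (grid G T) by exact: undup_uniq.
move: all; rewrite !(bigD1_seq eta) //= => all.
have rest : \sum_(i <- grid G T | i != eta)
      \sum_(t < T) dotp (g t) (expert_t i t) <=
    \sum_(i <- grid G T | i != eta) (2 * eps * G / N%:R).
  rewrite big_seq_cond [leRHS]big_seq_cond.
  by apply: ler_sum => i /andP[iS _]; exact: b.
move: tune; have -> : 2 * X * W = 2 * (M + P) * L * W by rewrite /X; ring.
have -> : 4 * G * (M + P) * L = 4 * G * X by rewrite /X; ring.
lra.
Qed.

Lemma Lambda_le :
  Lambda G T g <= 27 * (3 / 2 / ln 2) * (T%:R ^+ 3 * ln T%:R ^+ 3).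
Proof.
have T2' : 2 <= T%:R :> R by rewrite ler_nat.
have q3 : q T <= 3 * T%:R.
  rewrite /q VseqE //.
  have : (\sum_(s < T) enorm (g s) ^+ 2) / G ^+ 2 <= T%:R; last by lra.
  rewrite ler_pdivrMr ?exprn_gt0 //.
  apply: (@le_trans _ _ (\sum_(t < T) G ^+ 2)).
    by apply: ler_sum => t _; rewrite ler_pXn2r ?nnegrE ?enorm_ge0 ?gG // ltW.
  by rewrite sumr_const card_ord mulr_natl.
have q0 : 0 < q T by apply: lt_le_trans (q_ge4 T).
have l0 := lt_le_trans ltr01 (ln_ge4 (q_ge4 T)).
set t := T%:R in T2' q3 *; set y := ln t.
have y2 : ln 2 <= y by exact: lnT.
have y0 : 0 < y by apply: lt_le_trans y2.
have lq : ln (q T) <= 3 * y.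
  have -> : 3 * y = ln (t ^+ 3) by rewrite lnXn // -[RHS]mulr_natl.
  rewrite ler_ln ?posrE ?exprn_gt0 //; apply: (le_trans q3).
  (* [4 * t <= t ^+ 3] for [t >= 2], hence [q T <= 3 * t <= t ^+ 3]. *)
  have : 0 <= t * (t - 2) * (t + 2) by rewrite !mulr_ge0 //; lra.
  by lra.
have k1 : K%:R <= 3 / 2 / ln 2 * y.
  apply: (le_trans K_le); rewrite -/t -/y.
  have : 1 <= y / ln 2 by rewrite ler_pdivlMr // mul1r.
  by lra.
rewrite LambdaE -/t.
have lq2 : ln (q T) ^+ 2 <= (3 * y) ^+ 2.
  by rewrite ler_pXn2r ?nnegrE ?mulr_ge0 ?(ltW l0) ?(ltW y0).
apply: (@le_trans _ _ (t ^+ 2 * (3 * t) * (3 * y) ^+ 2 * (3 / 2 / ln 2 * y))).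
  have tq : 0 <= t ^+ 2 * q T by apply: mulr_ge0; [exact: sqr_ge0 | exact: ltW].
  apply: ler_pM => //; first by apply: mulr_ge0 tq _; exact: sqr_ge0.
  apply: ler_pM; rewrite ?sqr_ge0 //.
  by rewrite ler_wpM2l // sqr_ge0.
by rewrite le_eqVlt; apply/orP; left; apply/eqP; ring.
Qed.

End Learner.

Unset Implicit Arguments.

Theorem theorem4 (R : realType) :
  exists C : R,
  forall (d T : nat) (G eps : R)
    (l : nat -> 'rV[R]_d -> R) (g : nat -> 'rV[R]_d),
    (2 <= T)%N -> 0 < G -> 0 < eps ->
    (forall t, (t < T)%N -> convex_function setT (l t : 'rV[R]_d -> R^o)) ->
    (forall t, (t < T)%N -> elipschitz G (l t)) ->
    (forall t, (t < T)%N -> subgradient (l t) (play G eps T g t) (g t)) ->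
    (forall u : nat -> 'rV[R]_d,
       let M := max_norm T u in
       let P := path_length T u in
       let L := log_factor G eps T g u in
       \sum_(t < T) (l t (play G eps T g t) - l t (u t)) <=
         2 * eps * G
         + 6 * Num.sqrt (2 * (M + P) * L *
                         \sum_(t < T) enorm (g t) ^+ 2 * enorm (u t))
         + 4 * G * (M + P) * L)
    /\ Lambda G T g <= C * (T%:R ^+ 3 * ln T%:R ^+ 3).
Proof.
exists (27 * (3 / 2 / ln 2)) => d T G eps l g T2 G0 eps0 _ lG lg.
have gG t : (t < T)%N -> enorm (g t) <= G.
  by move=> tT; apply: subgradient_enorm (ltW G0) (lG t tT) (lg t tT).
split; last exact: Lambda_le T2 G0 gG.
move=> u; apply: le_trans (play_regret T2 G0 eps0 gG u).
(* The subgradient inequality at [u t] replaces each loss difference by its linearization. *)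
apply: ler_sum => t _; have := lg t (ltn_ord t) (u t).
by rewrite -(opprB (play _ _ _ _ _)) dotpNr; lra.
Qed.
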